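(* Let $a,b:[0,\infty)\to\mathbb{R}$ be Lebesgue measurable and essentially bounded, let $b^+(t)=\max\{b(t),0\}$, and let $t_0\ge 0$. Suppose at least one of the following conditions holds: 1) $a(t)\ge \int_{t_0}^t b^+(s)\,ds$ for $t\ge t_0$; 2) there exists $\lambda>0$ such that $a(t)\ge \lambda b^+(t)+\frac1\lambda$ for $t\ge t_0$; 3) $a(t)\ge 0$ for $t\ge t_0$ and there exists $\lambda>0$ such that $\int_{t_0}^t e^{-\int_s^t (a(\xi)-\lambda)\,d\xi}\,b^+(s)\,ds\le\lambda$ for $t\ge t_0$. Then the fundamental function and the fundamental system of $\ddot x(t)+a(t)\dot x(t)+b(t)x(t)=0$ are positive for $t\ge t_0$; that is, $X(t,s)>0$ for $t>s\ge t_0$, $x_1(t)>0$ for $t\ge t_0$, and $x_2(t)>0$ for $t>t_0$.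
   Context: Inequalities between coefficients are understood almost everywhere. A solution of the second order equation is a function with locally absolutely continuous derivative satisfying the equation almost everywhere. The fundamental function $X(t,s)$: for each fixed $s$, $X(\cdot,s)$ is the solution of $\ddot x+a\dot x+bx=0$ on $t\ge s$ with $x(s)=0$, $\dot x(s)=1$. The fundamental system (with initial point $t_0$) consists of the solutions $x_1,x_2$ of the homogeneous equation on $[t_0,\infty)$ with $x_1(t_0)=1,\dot x_1(t_0)=0$ and $x_2(t_0)=0,\dot x_2(t_0)=1$. *)

(* Defs.v *)
From HB Require Import structures.
From mathcomp Require Import all_boot all_order all_algebra.
From mathcomp Require Import all_classical all_reals all_analysis.

Set Implicit Arguments.
Unset Strict Implicit.
Unset Printing Implicit Defensive.

Import Order.TTheory GRing.Theory Num.Theory.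
Import numFieldNormedType.Exports.

Local Open Scope classical_set_scope.
Local Open Scope ring_scope.

(* Measurability is with respect to the Lebesgue (Caratheodory) sigma-algebra
   on the domain, the one of completed_lebesgue_measure; the default structure
   on R has only the Borel sets. *)
Definition lebesgue_measurable_fun (R : realType) (D : set R) (f : R -> R) :=
  @measurable_fun _ _ (caratheodory_type ((wlength (idfun : R -> R))^*)%mu) R
    D f.

Definition ess_bounded (R : realType) (D : set R) (f : R -> R) :=
  exists M : R, {ae @completed_lebesgue_measure R,
    forall t : R, D t -> `|f t| <= M}.

(* The limit is taken inside D, so the derivative is one-sided at an endpoint
   of D, and values of x outside D are irrelevant. *)
Definition has_derivative_on (R : realType) (D : set R) (x x' : R -> R) :=
  forall t : R, D t ->
    (x s - x t) / (s - t) @[s --> within D t^'] --> x' t.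

Definition absolutely_continuous_on (R : realType) (a b : R) (f : R -> R) :=
  forall e : R, 0 < e -> exists2 d : R, 0 < d &
    forall (n : nat) (l r : 'I_n -> R),
      (forall i, [/\ a <= l i, l i <= r i & r i <= b]) ->
      trivIset setT (fun i => `]l i, r i[%classic) ->
      \sum_(i < n) (r i - l i) < d ->
      \sum_(i < n) `|f (r i) - f (l i)| < e.

(* x solves x'' + a x' + b x = 0 on [s, +oo[ with x(s) = x0, x'(s) = v0;
   x' is the derivative of x there, and its own derivative x'^`() need only
   exist almost everywhere. *)
Definition is_ivp_solution (R : realType) (a b : R -> R) (s x0 v0 : R)
    (x : R -> R) :=
  exists x' : R -> R,
  [/\ has_derivative_on `[s, +oo[ x x',
      forall T : R, s <= T -> absolutely_continuous_on s T x',
      {ae @completed_lebesgue_measure R, forall t : R, s <= t ->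
        derivable x' t 1 /\ (x'^`())%classic t + a t * x' t + b t * x t = 0}
    & x s = x0 /\ x' s = v0].

Definition is_fundamental_function (R : realType) (a b : R -> R)
    (X : R -> R -> R) :=
  forall s : R, 0 <= s -> is_ivp_solution a b s 0 1 (fun t => X t s).

Definition is_fundamental_system (R : realType) (a b : R -> R) (t0 : R)
    (x1 x2 : R -> R) :=
  is_ivp_solution a b t0 1 0 x1 /\ is_ivp_solution a b t0 0 1 x2.

(* Main.v *)
Require Import Defs.
From HB Require Import structures.
From mathcomp Require Import all_boot all_order all_algebra.
From mathcomp Require Import all_classical all_reals all_analysis.
From mathcomp Require Import measurable_realfun.
From mathcomp Require Import ring lra.
Import Order.TTheory GRing.Theory Num.Theory.
Import numFieldNormedType.Exports.
Local Open Scope classical_set_scope.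
Local Open Scope ring_scope.

(** A Riccati comparison: if [u >= 0] satisfies [u' + u (a - u) >= b] almost
    everywhere, then [w = x' + u x] satisfies [w' >= (u - a) w] as long as
    [x >= 0], so [w] stays positive, and [x' + u x = w > 0] keeps [x] positive.
    The three conditions are the ones under which
    [u = \int_{t0}^t b^+], [u = 1 / lambda] and
    [u = e^{-A} \int_{t0}^t e^A b^+] with [A = \int_{t0}^t (a - lambda)]
    are such functions.  Since only an absolutely continuous [w] is available,
    the monotonicity argument uses that an absolutely continuous function with
    almost everywhere nonnegative derivative is nondecreasing.  For [x1], where
    [w] may vanish at [t0], one perturbs to [x1 + e x2] and lets [e] tend to 0. *)

(** * Lipschitz and absolutely continuous functions on a compact interval *)

Section AbsoluteContinuity.
Set Implicit Arguments.
Unset Strict Implicit.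
Variable R : realType.
Implicit Types (p q : R) (f g : R -> R).

Definition lipschitz_on p q f := exists L : R,
  forall s t, p <= s -> s <= t -> t <= q -> `|f t - f s| <= L * (t - s).

Lemma lipschitz_on_ge0 p q f : lipschitz_on p q f -> exists2 L : R, 0 < L &
  forall s t, p <= s -> s <= t -> t <= q -> `|f t - f s| <= L * (t - s).
Proof.
move=> [L fL]; exists (`|L| + 1) => [|s t ps st tq].
  by rewrite ltr_wpDl.
apply: (le_trans (fL s t ps st tq)); apply: ler_wpM2r; first by rewrite subr_ge0.
by rewrite (le_trans (ler_norm L))// lerDl.
Qed.

Lemma lipschitz_on_bounded p q f : lipschitz_on p q f ->
  exists K : R, forall t, p <= t -> t <= q -> `|f t| <= K.
Proof.
move=> /lipschitz_on_ge0[L L0 fL]; exists (`|f p| + L * (q - p)) => t pt tq.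
rewrite -[f t](subrK (f p)) addrC (le_trans (ler_normD _ _))// lerD2l.
rewrite (le_trans (fL _ _ (lexx p) pt tq))// ler_wpM2l ?(ltW L0)//.
by lra.
Qed.

Lemma lipschitz_on_comp p q c d f g :
  (forall t, p <= t -> t <= q -> c <= f t /\ f t <= d) ->
  lipschitz_on p q f -> lipschitz_on c d g -> lipschitz_on p q (g \o f).
Proof.
move=> fcd /lipschitz_on_ge0[L L0 fL] /lipschitz_on_ge0[M M0 gM].
exists (M * L) => s t ps st tq.
have [cfs fsd] := fcd _ ps (le_trans st tq).
have [cft ftd] := fcd _ (le_trans ps st) tq.
rewrite -mulrA; apply: (@le_trans _ _ (M * `|f t - f s|)).
  have [fst|/ltW fts] := leP (f s) (f t).
    by apply: (le_trans (gM _ _ cfs fst ftd)); rewrite ler_wpM2l ?(ltW M0)// ler_norm.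
  rewrite distrC [`|f t - _|]distrC.
  by apply: (le_trans (gM _ _ cft fts fsd)); rewrite ler_wpM2l ?(ltW M0)// ler_norm.
by rewrite ler_wpM2l ?(ltW M0)// fL.
Qed.

Lemma derivative_lipschitz_on p q f (df : R -> R) (K : R) :
  {within `[p, q], continuous f} ->
  (forall t, p < t -> t < q -> is_derive t 1 f (df t)) ->
  (forall t, p < t -> t < q -> `|df t| <= K) -> lipschitz_on p q f.
Proof.
move=> cf fdf dfK; exists K => s t ps; rewrite le_eqVlt => /predU1P[->|st] tq.
  by rewrite !subrr normr0 mulr0.
have [| |c /[!in_itv]/= /andP[sc ct] ->] := @MVT _ f df s t st.
- move=> x /[!in_itv]/= /andP[sx xt].
  by apply: fdf; [exact: le_lt_trans sx|exact: lt_le_trans tq].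
- apply: continuous_subspaceW cf => x /=; rewrite !in_itv/= => /andP[sx xt].
  by rewrite (le_trans ps sx) (le_trans xt tq).
have ts0 : 0 <= t - s by rewrite subr_ge0 ltW.
rewrite normrM [`|t - s|]ger0_norm// ler_wpM2r//.
by apply: dfK; [exact: le_lt_trans sc|exact: lt_le_trans tq].
Qed.

Lemma lipschitz_on_expR p q : lipschitz_on p q (@expR R).
Proof.
apply: (@derivative_lipschitz_on _ _ expR expR (expR q)).
- apply: continuous_subspaceT => x; exact: continuous_expR.
- by move=> t _ tq; rewrite ger0_norm ?expR_ge0// ler_expR ltW.
Qed.

Lemma lipschitz_ac p q f :
  lipschitz_on p q f -> absolutely_continuous_on p q f.
Proof.
move=> /lipschitz_on_ge0[L L0 fL] e e0; exists (e / L) => [|n l r lr _].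
  by rewrite divr_gt0.
rewrite ltr_pdivlMr// mulrC => lt_e; apply: le_lt_trans lt_e.
rewrite mulr_sumr; apply: ler_sum => i _.
by have [pl lri rq] := lr i; exact: fL.
Qed.

Lemma ac_sub p q p' q' f : p <= p' -> q' <= q ->
  absolutely_continuous_on p q f -> absolutely_continuous_on p' q' f.
Proof.
move=> pp qq acf e /acf[d d0 fd]; exists d => // n l r lr; apply: fd => i.
have [pl lri rq] := lr i; split => //; [exact: le_trans pl|exact: le_trans qq].
Qed.

Lemma ac_add p q f g :
  absolutely_continuous_on p q f -> absolutely_continuous_on p q g ->
  absolutely_continuous_on p q (fun t => f t + g t).
Proof.
move=> acf acg e e0; have e20 : 0 < e / 2 by rewrite divr_gt0.
have [d d0 fd] := acf _ e20; have [d' d'0 gd] := acg _ e20.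
exists (Num.min d d') => [|n l r lr tlr]; first by rewrite lt_min d0.
rewrite lt_min => /andP[/(fd _ _ _ lr tlr) ? /(gd _ _ _ lr tlr) ?].
apply: (@le_lt_trans _ _ (\sum_(i < n) `|f (r i) - f (l i)| +
                          \sum_(i < n) `|g (r i) - g (l i)|)); last by lra.
rewrite -big_split; apply: ler_sum => i _ /=.
by rewrite opprD addrACA ler_normD.
Qed.

Lemma ac_continuous p q f : absolutely_continuous_on p q f ->
  {within `[p, q], continuous f}.
Proof.
move=> acf; apply/subspace_continuousP => t /=; rewrite in_itv/= => /andP[pt tq].
apply/cvgrPdist_lt => e /acf[d d0 fd]; rewrite near_withinE.
exists d => //= s /= tsd; rewrite in_itv/= => /andP[ps sq].
(* A family of one interval suffices, with its endpoints ordered by [Num.min] and [Num.max]. *)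
have := fd 1%N (fun=> Num.min s t) (fun=> Num.max s t).
rewrite !big_ord1; have [st|ts] := leP s t => fd1.
- apply: fd1 => //; first by move=> i j _ _ _; rewrite !ord1.
  by rewrite ger0_norm ?subr_ge0 in tsd.
- move/ltW in ts; rewrite distrC; apply: fd1 => //.
    by move=> i j _ _ _; rewrite !ord1.
  by rewrite distrC ger0_norm ?subr_ge0// in tsd.
Qed.

Lemma continuous_on_bounded p q f : {within `[p, q], continuous f} ->
  exists2 K : R, 0 < K & forall t, p <= t -> t <= q -> `|f t| <= K.
Proof.
move=> cf; have [pq|qp] := leP p q; last first.
  by exists 1 => // t pt tq; have := le_lt_trans (le_trans pt tq) qp; rewrite ltxx.
have [c _ cmax] := EVT_max pq cf; have [d _ dmin] := EVT_min pq cf.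
exists (`|f c| + `|f d| + 1) => [|t pt tq].
  by rewrite ltr_wpDl// addr_ge0.
have tpq : t \in `[p, q] by rewrite in_itv/= pt.
have := cmax _ tpq; have := dmin _ tpq.
have := ler_norm (f c); have := ler_norm (- f d); rewrite normrN.
have := normr_ge0 (f c); have := normr_ge0 (f d).
by rewrite ler_norml => ? ? ? ? ? ?; apply/andP; split; lra.
Qed.

Lemma ac_mul p q f g :
  absolutely_continuous_on p q f -> absolutely_continuous_on p q g ->
  absolutely_continuous_on p q (fun t => f t * g t).
Proof.
move=> acf acg e e0.
have [K K0 fK] := continuous_on_bounded (ac_continuous acf).
have [L L0 gL] := continuous_on_bounded (ac_continuous acg).
(* Half of [e] goes to each factor, divided by the bound on the other one. *)
have eL0 : 0 < e / (2 * L) by rewrite divr_gt0// mulr_gt0.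
have eK0 : 0 < e / (2 * K) by rewrite divr_gt0// mulr_gt0.
have [d d0 fd] := acf _ eL0; have [d' d'0 gd] := acg _ eK0.
exists (Num.min d d') => [|n l r lr tlr]; first by rewrite lt_min d0.
rewrite lt_min => /andP[/(fd _ _ _ lr tlr) fe /(gd _ _ _ lr tlr) ge].
apply: (@le_lt_trans _ _ (L * \sum_(i < n) `|f (r i) - f (l i)| +
                          K * \sum_(i < n) `|g (r i) - g (l i)|)).
  rewrite !mulr_sumr -big_split; apply: ler_sum => i _ /=.
  have [pl lri rq] := lr i.
  have -> : f (r i) * g (r i) - f (l i) * g (l i) =
     g (r i) * (f (r i) - f (l i)) + f (l i) * (g (r i) - g (l i)) by ring.
  rewrite (le_trans (ler_normD _ _))// !normrM lerD// ler_wpM2r//.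
    by rewrite gL// (le_trans pl).
  by rewrite fK// (le_trans lri).
have -> : e = L * (e / (2 * L)) + K * (e / (2 * K)).
  by field; rewrite !gt_eqF.
by rewrite ltrD// ltr_pM2l.
Qed.

End AbsoluteContinuity.

(** * Monotonicity from an almost everywhere nonnegative derivative *)

Section MonotoneAbsolutelyContinuous.
Variable R : realType.
Set Implicit Arguments.
Unset Strict Implicit.
Notation mu := (@lebesgue_measure R).

(** The head of the list is the rightmost interval, so a chain grows to the right by a cons. Empty
    intervals are allowed, as in [absolutely_continuous_on]. *)
Definition chain_in (U : set R) (p t : R) (s : seq (R * R)) :=
  [/\ forall x, x \in s -> [/\ p <= x.1, x.1 <= x.2 & x.2 <= t],
      forall x, x \in s -> `]x.1, x.2[ `<=` U
    & pairwise (fun x y : R * R => y.2 <= x.1) s].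

Lemma chain_in_trivIset (U : set R) (p t : R) (s : seq (R * R)) :
  chain_in U p t s ->
  trivIset setT (fun i : 'I_(size s) =>
    `](nth (0, 0) s i).1, (nth (0, 0) s i).2[%classic).
Proof.
move=> [_ _ /(pairwiseP (0, 0)) sp] i j _ _ [x []] /=.
rewrite !in_itv/= => /andP[ix xi] /andP[jx xj]; apply/val_inj.
have [ij|ji|//] := ltngtP i j.
- have := sp i j (ltn_ord i) (ltn_ord j) ij.
  by move=> /le_lt_trans -/(_ _ ix) /(lt_trans xj); rewrite ltxx.
- have := sp j i (ltn_ord j) (ltn_ord i) ji.
  by move=> /le_lt_trans -/(_ _ jx) /(lt_trans xi); rewrite ltxx.
Qed.

(** By disjointness the total length is the measure of the union, which lies in [U]. *)
Lemma chain_in_length (U : set R) (p t : R) (s : seq (R * R)) :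
  measurable U -> chain_in U p t s ->
  ((\sum_(i < size s) ((nth (0, 0) s i).2 - (nth (0, 0) s i).1))%:E <= mu U)%E.
Proof.
move=> mU sU; have [pt sub _] := sU.
pose F (i : 'I_(size s)) : set (measurableTypeR R) :=
  `](nth (0, 0) s i).1, (nth (0, 0) s i).2[%classic.
have mF i : measurable (F i) by exact: measurable_itv.
have mbF : measurable (\big[setU/set0]_(i < size s) F i).
  by apply: bigsetU_measurable => i _.
apply: (@le_trans _ _ (mu (\big[setU/set0]_(i < size s) F i))); last first.
  apply: le_measure; rewrite ?inE//.
  apply/(big_ind (fun A => A `<=` U)) => [//|A B AU BU|i _].
    by rewrite subUset.
  by apply: sub; exact: mem_nth.
rewrite measure_semi_additive_ord//; last exact: chain_in_trivIset sU.
rewrite -sumEFin; apply: lee_sum => i _.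
rewrite -[X in (_ <= X)%E]/(lebesgue_measure (F i)) lebesgue_measure_itv.
rewrite /= lte_fin; have [_ + _] := pt _ (mem_nth (0, 0) (ltn_ord i)).
rewrite le_eqVlt => /predU1P[->|->]; last by rewrite EFinB.
by rewrite ltxx subrr.
Qed.

(* Covering argument on [p, q]: every short interval around a point is either
   contained in the small open set U or has an almost nonnegative increment. *)
Lemma chain_in_exists (U : set R) (p q e : R) (f : R -> R) : 0 <= e -> p <= q ->
  (forall t, p <= t -> t <= q -> exists2 d : R, 0 < d &
    forall l r, p <= l -> l <= t -> t <= r -> r <= q -> t - d < l -> r < t + d ->
      `]l, r[ `<=` U \/ - (e * (r - l)) <= f r - f l) ->
  exists2 s, chain_in U p q s &
    - (e * (q - p)) <= f q - f p +
      \sum_(i < size s) `|f (nth (0, 0) s i).2 - f (nth (0, 0) s i).1|.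
Proof.
move=> e0 pq loc.
(* Continuous induction along [[p, q]]: [P t] says that the variation along a chain pays for any
   decrease of [f] on [[p, t]], up to a loss of [e] per unit length. *)
pose P (t : R) := exists2 s, chain_in U p t s & - (e * (t - p)) <= f t - f p +
      \sum_(i < size s) `|f (nth (0, 0) s i).2 - f (nth (0, 0) s i).1|.
have step l r : p <= l -> l <= r -> P l ->
    `]l, r[ `<=` U \/ - (e * (r - l)) <= f r - f l -> P r.
  (* An interval inside [U] joins the chain, where [|f r - f l|] absorbs the decrease; otherwise the
     chain is kept and the loss is at most [e * (r - l)]. *)
  move=> pl lr [s [sp sU ss] fs] [lrU|flr].
    exists ((l, r) :: s).
      split => [x|x|/=].
      - rewrite inE => /predU1P[->//|/sp[? ? xl]]; split => //.
        exact: le_trans lr.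
      - by rewrite inE => /predU1P[->//|/sU].
      - by rewrite ss andbT; apply/allP => x /sp[_ _].
    rewrite big_ord_recl /=.
    have : f l - f r <= `|f r - f l| by rewrite distrC ler_norm.
    have : 0 <= e * (r - l) by rewrite mulr_ge0// subr_ge0.
    by move: fs; set S := \sum_(i < _) _; lra.
  exists s; last by lra.
  by split => // x /sp[? ? xl]; split => //; exact: le_trans lr.
have P0 : P p.
  exists [::]; first by split.
  by rewrite big_ord0 !subrr mulr0 oppr0 addr0.
pose S := [set t | [/\ p <= t, t <= q & P t]].
have Sp : S p by split.
have supS : has_sup S by split; [exists p|exists q => t []].
pose c := sup S.
have pc : p <= c by apply: ub_le_sup => //; case: supS.
have cq : c <= q by apply: ge_sup => [|t []//]; exists p.
(* At the supremum [c] of the reached points, some [l] in [S] with [c - d < l] gives [P c]; if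
   [c < q], a point [r] slightly to the right of [c] would also be in [S]. *)
have [d d0 dc] := loc c pc cq.
have [l [pl lq Pl] cdl] := sup_adherent d0 supS.
have lc : l <= c by apply: ub_le_sup => //; case: supS.
have Pc : P c.
  by apply: (step l c) => //; apply: dc => //; rewrite ltrDl.
have [qc|cltq] := leP q c; first by have -> : q = c by apply/le_anti/andP.
pose r := Num.min q (c + d / 2).
have d20 : 0 < d / 2 by rewrite divr_gt0.
have cr : c < r by rewrite lt_min cltq ltrDl.
have rq : r <= q by rewrite ge_min lexx.
have rcd : r < c + d.
  by rewrite (@le_lt_trans _ _ (c + d / 2))// ?ge_min ?lexx ?orbT//; lra.
have Sr : S r.
  split => //; first exact: le_trans (ltW cr).
  apply: (step c r) => //; first exact: ltW.
  by apply: dc => //; [exact: ltW|lra].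
by have := ub_le_sup supS.2 Sr; rewrite leNgt cr.
Qed.

(** Outer regularity is applied to a measurable null set [A] containing [N]. *)
Lemma null_set_open_cover (N : set R) (d : R) : mu.-negligible N -> 0 < d ->
  exists U : set R, [/\ open U, N `<=` U & (mu U < d%:E)%E].
Proof.
move=> [A [mA A0 NA]] d0.
have [|U [oU AU UA]] := lebesgue_regularity_outer mA _ d0; first by rewrite -[ltLHS]/(mu A) A0.
exists U; split => //; first exact: subset_trans AU.
have mU : measurable (U : set (measurableTypeR R)) by exact: open_measurable.
have mUA : measurable (U `\` A : set (measurableTypeR R)) by exact: measurableD.
apply: le_lt_trans UA; rewrite -[leLHS]/(mu U) -{1}(setDUK AU).
by apply: (le_trans (measureU2 mu mA mUA)); rewrite -[X in (X + _)%E]/(mu A) A0 add0e.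
Qed.

(** The Caratheodory slope [g] at [t] is continuous there with [g t = df >= 0], hence exceeds [- e]
    nearby; the increment over an interval around [t] is a sum of two slopes weighted by the
    distances to [t]. *)
Lemma ge0_derive_increment (f : R -> R) (t df e : R) :
  is_derive t 1 f df -> 0 <= df -> 0 < e -> exists2 d : R, 0 < d &
    forall l r, l <= t -> t <= r -> t - d < l -> r < t + d ->
      - (e * (r - l)) <= f r - f l.
Proof.
move=> /is_derive1_caratheodory[g [fg cg gt]] df0 e0.
have /cvgrPdist_lt/(_ _ e0)[d /= d0 gd] := cg.
exists d => // l r lt tr dl rd.
have gd' z : `|t - z| < d -> - e < g z.
  by move=> /gd; rewrite gt /= ltr_norml => /andP[_]; lra.
have gl : - e < g l by apply: gd'; rewrite ger0_norm ?subr_ge0//; lra.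
have gr : - e < g r.
  by apply: gd'; rewrite distrC ger0_norm ?subr_ge0//; lra.
have -> : f r - f l = g r * (r - t) + g l * (t - l).
  by have := fg l; have := fg r; lra.
have : 0 <= (g r + e) * (r - t) by rewrite mulr_ge0//; lra.
have : 0 <= (g l + e) * (t - l) by rewrite mulr_ge0//; lra.
by lra.
Qed.

(** The exceptional points have an open cover [U] so small that the variation of [f] along any chain
    in [U] is below [e]. Elsewhere [f] loses at most [e] per unit length, so its total drop is less
    than [e * (q - p + 1)]. *)
Lemma ac_ae_nondecreasing (p q : R) (f : R -> R) : p <= q ->
  absolutely_continuous_on p q f ->
  {ae mu, forall t : R, p < t -> t < q ->
    exists2 df : R, is_derive t 1 f df & 0 <= df} ->
  f p <= f q.
Proof.
move=> pq acf aef; rewrite leNgt; apply/negP => fqp.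
(* With this [e] the allowed loss [e * (q - p + 1)] is half of the assumed drop. *)
pose e := (f p - f q) / (2 * (q - p + 1)).
have qp1 : 0 < q - p + 1 by lra.
have e0 : 0 < e by rewrite divr_gt0// ?subr_gt0// mulr_gt0.
have [d d0 fd] := acf _ e0.
(* The endpoints, about which the hypothesis says nothing, join the exceptional set. *)
pose N := (~` [set t | p < t -> t < q ->
    exists2 df : R, is_derive t 1 f df & 0 <= df]) `|` [set p; q].
have negN : mu.-negligible N.
  apply: negligibleU => //.
  by apply: negligibleU; apply/negligibleP => //; exact: lebesgue_measure_set1.
have [U [oU NU Ud]] := null_set_open_cover negN d0.
have mU : measurable (U : set (measurableTypeR R)) by exact: open_measurable.
have [//||s sU fs] := @chain_in_exists U p q e f (ltW e0).
  move=> t pt tq; have [/NU Ut|Nt] := pselect (N t).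
    have [a /= a0 aU] := oU _ Ut; exists a => // l r pl lt tr rq al ra; left.
    move=> x /=; rewrite in_itv/= => /andP[lx xr]; apply: aU => /=.
    by rewrite ltr_norml; apply/andP; split; lra.
  have [df fdf df0] : exists2 df : R, is_derive t 1 f df & 0 <= df.
    have pnt : p != t by apply/eqP => ?; apply: Nt; right; left.
    have tnq : t != q by apply/eqP => ?; apply: Nt; right; right.
    apply: contrapT => nt; apply: Nt; left => /(_ _ _)/nt; apply.
    - by rewrite lt_neqAle pnt.
    - by rewrite lt_neqAle tnq.
  have [a a0 fa] := ge0_derive_increment fdf df0 e0.
  by exists a => // l r pl lt tr rq al ra; right; exact: fa.
have := fd (size s) (fun i => (nth (0, 0) s i).1) (fun i => (nth (0, 0) s i).2).
move=> /(_ _ (chain_in_trivIset sU) _)-/(_ _ _)fe.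
have {}fe : \sum_(i < size s)
    `|f (nth (0, 0) s i).2 - f (nth (0, 0) s i).1| < e.
  apply: fe; first by case: sU => sp _ _ i; apply: sp; exact: mem_nth.
  by rewrite -lte_fin (le_lt_trans (chain_in_length mU sU)).
have : e * (q - p + 1) = (f p - f q) / 2 by rewrite /e; field; rewrite gt_eqF.
by lra.
Qed.
End MonotoneAbsolutelyContinuous.

(** * First nonpositive points, negative minima and exponential weights *)

Section RiccatiComparison.
Variable R : realType.
Set Implicit Arguments.
Unset Strict Implicit.
Notation mu := (@lebesgue_measure R).

(** [tau] is the infimum of the points where [w <= 0]; continuity puts it among them, and [0 < w p]
    separates it from [p]. *)
Lemma first_nonpositive (p q : R) (w : R -> R) :
  {within `[p, q], continuous w} -> 0 < w p ->
  (exists t, [/\ p <= t, t <= q & w t <= 0]) ->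
  exists tau, [/\ p < tau, tau <= q, w tau <= 0 &
    forall r, p <= r -> r < tau -> 0 < w r].
Proof.
move=> /subspace_continuousP cw wp [t0 [pt0 t0q wt0]].
pose Z := [set t | [/\ p <= t, t <= q & w t <= 0]].
have Zt0 : Z t0 by [].
have infZ : has_inf Z by split; [exists t0|exists p => t []].
pose tau := inf Z.
have ptau : p <= tau by apply: lb_le_inf => [|t []//]; exists t0.
have tauq : tau <= q by rewrite (le_trans _ t0q)// ge_inf//; case: infZ.
have tau_pos r : p <= r -> r < tau -> 0 < w r.
  move=> pr rt; rewrite ltNge; apply/negP => wr.
  suff : tau <= r by rewrite leNgt rt.
  apply: ge_inf; first by case: infZ.
  by split => //; rewrite (le_trans (ltW rt)).
have wtau : w tau <= 0.
  rewrite leNgt; apply/negP => wtau0.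
  have tpq : `[p, q]%classic tau by rewrite /= in_itv/= ptau.
  have /cvgrPdist_lt/(_ _ wtau0) := cw tau tpq.
  rewrite near_withinE => -[d /= d0 wd].
  have [z [pz zq wz] ztau] := inf_adherent d0 infZ.
  have tz : tau <= z by apply: ge_inf; [case: infZ|].
  have := wd z; rewrite /= in_itv/= pz zq distrC ger0_norm ?subr_ge0// => wdz.
  have := wdz _ isT; rewrite ltr_norml => /(_ _)/andP.
  have zd : z - tau < d by rewrite ltrBlDl.
  by rewrite /from_subspace => /(_ zd)[_ ?]; lra.
exists tau; split => //; rewrite lt_neqAle ptau andbT.
by apply/eqP => pE; move: wtau; rewrite -pE leNgt wp.
Qed.

Lemma pos_derive_lt_left (f : R -> R) (t df s : R) : is_derive t 1 f df ->
  0 < df -> s < t -> exists r, [/\ s <= r, r < t & f r < f t].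
Proof.
move=> /is_derive1_caratheodory[g [fg cg gt]] df0 st.
have /cvgrPdist_lt/(_ _ df0)[d /= d0 gd] := cg.
pose r := Num.max s (t - d / 2).
have d20 : 0 < d / 2 by rewrite divr_gt0.
have rt : r < t by rewrite gt_max st/=; lra.
have rd : t - d / 2 <= r by rewrite le_max lexx orbT.
have gr : 0 < g r.
  have : `|t - r| < d by rewrite ger0_norm ?subr_ge0 ?(ltW rt)//; lra.
  by move=> /gd; rewrite gt /= ltr_norml => /andP[_]; lra.
exists r; split => //; first by rewrite le_max lexx.
have : 0 < g r * (t - r) by rewrite mulr_gt0// subr_gt0.
by have := fg r; lra.
Qed.

(* At a negative minimum of x the hypothesis forces a positive derivative. *)
Lemma pos_feedback_ge0 (p q : R) (x x' u : R -> R) :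
  {within `[p, q], continuous x} ->
  (forall t, p < t -> t < q -> is_derive t 1 x (x' t)) ->
  0 <= x p -> (forall t, p < t -> t < q -> 0 <= u t) ->
  (forall t, p < t -> t < q -> 0 < x' t + u t * x t) ->
  forall t, p < t -> t < q -> 0 <= x t.
Proof.
move=> cx dx xp u0 w0 t pt tq; rewrite leNgt; apply/negP => xt.
(* Minimizing over [[p, t]] only keeps the minimizer strictly below [q], where the derivative
   hypotheses apply. *)
have cxt : {within `[p, t], continuous x}.
  apply: continuous_subspaceW cx => r /=; rewrite !in_itv/= => /andP[->/=].
  by move=> /le_trans; apply; exact: ltW.
have [c /[!in_itv]/= /andP[pc ct] cmin] := EVT_min (ltW pt) cxt.
have xc : x c < 0.
  by apply: le_lt_trans xt; apply: cmin; rewrite in_itv/= ltW//= lexx.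
have {}pc : p < c.
  rewrite lt_neqAle pc andbT; apply/eqP => pE; move: xc.
  by rewrite -pE ltNge xp.
have cq : c < q by exact: le_lt_trans tq.
have x'c : 0 < x' c.
  have : u c * x c <= 0 by rewrite mulr_ge0_le0 ?u0// ltW.
  by have := w0 c pc cq; lra.
have [r [pr rc]] := pos_derive_lt_left (dx c pc cq) x'c pc.
by rewrite ltNge cmin// in_itv/= pr (le_trans (ltW rc)).
Qed.

(** An integrating factor: it turns a lower bound [- K * w t <= dw] into a nonnegative
    derivative. *)
Lemma is_derive_expRM (K t dw : R) (w : R -> R) : is_derive t 1 w dw ->
  is_derive t 1 (fun s => expR (K * s) * w s) (expR (K * t) * (K * w t + dw)).
Proof.
move=> wdw.
have dK : is_derive t 1 (fun s : R => K * s) K.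
  have := is_deriveZ K (@is_derive_id _ _ t 1).
  by rewrite /GRing.scale/= mulr1.
have dE := is_derive1_comp (is_derive_expR (K * t)) dK.
have := is_deriveM dE wdw.
by move=> /is_derive_eq; apply; rewrite /GRing.scale/=; ring.
Qed.

Lemma ac_expRM (p q K : R) (w : R -> R) : absolutely_continuous_on p q w ->
  absolutely_continuous_on p q (fun s => expR (K * s) * w s).
Proof.
apply: ac_mul; apply: lipschitz_ac.
have lK : lipschitz_on p q (fun s => K * s).
  exists `|K| => s t ps st tq.
  by rewrite -mulrBr normrM [`|t - s|]ger0_norm// subr_ge0.
have [B B0] := lipschitz_on_bounded lK.
apply: lipschitz_on_comp lK (lipschitz_on_expR (- B) B) => t pt tq.
by apply/andP; rewrite -ler_norml B0.
Qed.

End RiccatiComparison.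

(** * Positivity of the Riccati transform and of the solution *)

Section RiccatiPositivity.
Variable R : realType.
Set Implicit Arguments.
Unset Strict Implicit.
Notation mu := (@lebesgue_measure R).
Variables (a b x x' u : R -> R) (p q M : R).
Hypothesis cx : {within `[p, q], continuous x}.
Hypothesis dx : forall t, p < t -> t < q -> is_derive t 1 x (x' t).
Hypothesis acx' : absolutely_continuous_on p q x'.
Hypothesis aex : {ae mu, forall t, p < t -> t < q ->
  is_derive t 1 x' (- (a t * x' t) - b t * x t)}.
Hypothesis acu : absolutely_continuous_on p q u.
Hypothesis u_ge0 : forall t, p <= t -> t <= q -> 0 <= u t.
Hypothesis aeu : {ae mu, forall t, p < t -> t < q ->
  exists2 du, is_derive t 1 u du & b t <= du + u t * (a t - u t)}.
Hypothesis aea : {ae mu, forall t, p < t -> t < q -> `|a t| <= M}.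
Hypothesis x_ge0 : 0 <= x p.
Let w t := x' t + u t * x t.
Hypothesis w_gt0 : 0 < w p.

Let acx : absolutely_continuous_on p q x.
Proof.
have [K _ x'K] := continuous_on_bounded (ac_continuous acx').
apply/lipschitz_ac/(derivative_lipschitz_on cx dx (K := K)) => t pt tq.
by rewrite x'K// ltW.
Qed.

Let acw : absolutely_continuous_on p q w.
Proof. by apply: ac_add => //; exact: ac_mul. Qed.

(** Substituting the equation leaves, as the coefficient of [x t], the Riccati defect that [aeu]
    makes nonnegative. *)
Let is_derive_w (t du : R) : is_derive t 1 x (x' t) ->
  is_derive t 1 x' (- (a t * x' t) - b t * x t) -> is_derive t 1 u du ->
  is_derive t 1 w ((u t - a t) * w t + (du + u t * (a t - u t) - b t) * x t).
Proof.
move=> xx' dx' udu; have := is_deriveD dx' (is_deriveM udu xx').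
by move=> /is_derive_eq; apply; rewrite /GRing.scale/= /w; ring.
Qed.

(* As long as w and x are nonnegative, w' >= (u - a) w >= - K w. *)
Lemma riccati_transform_gt0 t : p <= t -> t <= q -> 0 < w t.
Proof.
move=> pt tq; rewrite ltNge; apply/negP => wt.
have [|||tau [ptau tauq wtau w0]] := @first_nonpositive _ p q w.
- exact: ac_continuous.
- exact: w_gt0.
- by exists t.
have cxtau : {within `[p, tau], continuous x}.
  apply: continuous_subspaceW cx => r /=; rewrite !in_itv/= => /andP[->/=].
  by move=> /le_trans; apply.
have x0 : forall r, p < r -> r < tau -> 0 <= x r.
  apply: (pos_feedback_ge0 cxtau (x' := x') (u := u)) => //.
  - by move=> r pr rt; apply: dx => //; exact: lt_le_trans tauq.
  - by move=> r pr rt; apply: u_ge0; [exact: ltW|exact: le_trans (ltW rt) _].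
  - by move=> r pr rt; apply: w0 => //; exact: ltW.
(* As [a <= M] and [0 <= u] almost everywhere, this weight gives [v] a nonnegative derivative up to
   [tau], so [v] cannot pass from [v p > 0] to [v tau <= 0]. *)
pose v r := expR (M * r) * w r.
have acv : absolutely_continuous_on p tau v.
  exact: ac_sub (lexx _) tauq (ac_expRM M acw).
have aev : {ae mu, forall r, p < r -> r < tau ->
    exists2 dv, is_derive r 1 v dv & 0 <= dv}.
  have FF := ae_filter_ringOfSetsType mu.
  apply: filterS3 aeu aex aea => r aeu_r aex_r aea_r pr rt.
  have rq : r < q by exact: lt_le_trans tauq.
  have [du udu bu] := aeu_r pr rq; have dx' := aex_r pr rq.
  have /ler_normlP[_ aM] := aea_r pr rq.
  eexists; first exact: is_derive_expRM (is_derive_w (dx pr rq) dx' udu).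
  rewrite mulr_ge0// ?expR_ge0//.
  have wr : 0 < w r by apply: w0 => //; exact: ltW.
  have ur : 0 <= u r by apply: u_ge0; exact: ltW.
  have : 0 <= (M - a r + u r) * w r by rewrite mulr_ge0 ?(ltW wr)//; lra.
  have : 0 <= (du + u r * (a r - u r) - b r) * x r by rewrite mulr_ge0 ?x0//; lra.
  by lra.
have : v p <= v tau by apply: ac_ae_nondecreasing => //; exact: ltW.
have : 0 < v p by rewrite mulr_gt0// expR_gt0.
have : v tau <= 0 by rewrite mulr_ge0_le0// expR_ge0.
by lra.
Qed.

(** With [K] a bound for [u] and [x >= 0], one has [x' + K x >= x' + u x > 0], so by the mean value
    theorem [expR (K * t) * x t] exceeds its nonnegative initial value. *)
Lemma riccati_positive t : p < t -> t <= q -> 0 < x t.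
Proof.
move=> pt tq.
have x0 : forall r, p < r -> r < q -> 0 <= x r.
  apply: (pos_feedback_ge0 cx (x' := x') (u := u)) => //.
  - by move=> r pr rt; apply: u_ge0; exact: ltW.
  - by move=> r pr rt; apply: riccati_transform_gt0; exact: ltW.
have [K K0 uK] := continuous_on_bounded (ac_continuous acu).
pose z r := expR (K * r) * x r.
have cz : {within `[p, t], continuous z}.
  exact: ac_continuous (ac_sub (lexx _) tq (ac_expRM K acx)).
have dz r : r \in `]p, t[ -> is_derive r 1 z (expR (K * r) * (K * x r + x' r)).
  rewrite in_itv/= => /andP[pr rt]; apply: is_derive_expRM.
  by apply: dx => //; exact: lt_le_trans tq.
have [r /[!in_itv]/= /andP[pr rt] ztp] := MVT pt dz cz.
have rq : r < q by exact: lt_le_trans tq.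
have : 0 < z t - z p.
  rewrite ztp !mulr_gt0 ?expR_gt0 ?subr_gt0//.
  have /ler_normlP[_ urK] : `|u r| <= K by apply: uK; exact: ltW.
  have wr : 0 < w r by apply: riccati_transform_gt0; exact: ltW.
  have : 0 <= (K - u r) * x r by rewrite mulr_ge0 ?x0// subr_ge0.
  by rewrite /w in wr; lra.
have : 0 <= z p by rewrite mulr_ge0// expR_ge0.
move=> zp ztp0; have : 0 < z t by lra.
by rewrite /z pmulr_rgt0// expR_gt0.
Qed.

End RiccatiPositivity.

(** * Null sets and Borel modifications of Lebesgue measurable functions *)

Section LebesgueBorel.
Variable R : realType.
Set Implicit Arguments.
Unset Strict Implicit.
Notation mu := (@lebesgue_measure R).
Notation cmu := (@completed_lebesgue_measure R).

(** A set of the completed sigma-algebra is the union of a Borel set and a negligible one, so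
    completion creates no new null sets. *)
Lemma completed_negligible (N : set R) : cmu.-negligible N <-> mu.-negligible N.
Proof.
split=> [[A [mA A0 NA]]|[A [mA A0 NA]]]; last first.
  by exists A; split => //; exact: sub_caratheodory.
have : completed_algebra_gen mu A.
  by rewrite -g_sigma_completed_algebra_genE completed_caratheodory_measurable.
move=> [B mB [N' negN' AE]].
apply: (@negligibleS _ _ _ mu _ _ NA); rewrite -AE; apply: negligibleU => //.
exists B; split => //; apply/eqP; rewrite -measure_le0 -A0.
by apply: le_outer_measure; rewrite -AE; exact: subsetUl.
Qed.

Lemma completed_ae (P : set R) : {ae cmu, forall t, P t} <-> {ae mu, forall t, P t}.
Proof. exact: completed_negligible. Qed.

(** At each rational level the superlevel set of [h] is Borel up to a null set. Setting [h] to zero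
    on one Borel null set that contains all these exceptions makes the superlevel sets Borel. *)
Lemma borel_modification (h : R -> R) : lebesgue_measurable_fun setT h ->
  exists2 g : R -> R, measurable_fun setT (g : measurableTypeR R -> R) &
    {ae mu, forall t, h t = g t}.
Proof.
(* [e] runs over all rationals; a natural number that codes none gives 0. *)
move=> mh; pose e (n : nat) : R := ratr (odflt (0 : rat) (unpickle n)).
have E n : exists BN : set R * set R, [/\ measurable (BN.1 : set (measurableTypeR R)),
    mu.-negligible BN.2 & h @^-1` `]e n, +oo[ = BN.1 `|` BN.2].
  have : completed_algebra_gen mu (h @^-1` `]e n, +oo[).
    rewrite -g_sigma_completed_algebra_genE completed_caratheodory_measurable.
    by rewrite -[X in measurable X]setTI; apply: mh.
  by move=> [B mB [N nN <-]]; exists (B, N).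
have [BN EBN] := choice E.
have [A [mA A0 NA]] : mu.-negligible (\bigcup_n (BN n).2).
  by apply: negligible_bigcup => n; have [] := EBN n.
pose g t := if t \in A then 0 else h t.
exists g; last first.
  apply: (@negligibleS _ _ _ _ A); last by exists A; split.
  move=> t /=; rewrite /g; case: ifPn => [/set_mem//|_].
  by move/(_ erefl).
apply: (measurability _ (RGenOInfty.measurableE R)).
move=> _ [_ [x ->] <-]; rewrite setTI.
(* Off [A], the real level [x] is reached through the rational levels above it; on [A], the value 0
   exceeds [x] exactly when [x < 0]. *)
rewrite (_ : _ @^-1` _ = (\bigcup_(n in [set n | x < e n]) ((BN n).1 `\` A)) `|`
   (if x < 0 then A else set0)).
  apply: measurableU; last by case: ifP.
  apply: bigcup_measurable => n _; apply: measurableD => //.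
  by have [] := EBN n.
apply/seteqP; split => t /=; rewrite in_itv/= andbT /g; have [tA|tA] := boolP (t \in A).
- by move=> x0; right; rewrite x0; exact: set_mem.
- move: tA => /negP At xh; left.
  have [r /[!in_itv]/= /andP[xr rh]] := rat_in_itvoo xh.
  have En : e (pickle r) = ratr r by rewrite /e pickleK.
  exists (pickle r); rewrite /= ?En//; split; last by move=> /mem_set.
  have [_ _ hBN] := EBN (pickle r).
  have : (h @^-1` `]e (pickle r), +oo[) t by rewrite /= in_itv/= En rh.
  by rewrite hBN => -[//|Nt]; exfalso; apply/At/mem_set/NA; exists (pickle r).
- move: tA => /set_mem At [[n _ [_ /(_ At)]]//|].
  by case: ifP.
- move: tA => /negP At [[n /= xn [Bt _]]|]; last first.
    by case: ifP => // _ /mem_set.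
  have [_ _ hBN] := EBN n; apply: (lt_trans xn).
  have : (h @^-1` `]e n, +oo[) t by rewrite hBN; left.
  by rewrite /= in_itv/= andbT.
Qed.

Lemma bounded_borel_modification (f : R -> R) :
  lebesgue_measurable_fun `[0, +oo[ f -> ess_bounded `[0, +oo[ f ->
  exists2 g : R -> R, measurable_fun setT (g : measurableTypeR R -> R) &
    (exists M, forall t, `|g t| <= M) /\ {ae mu, forall t, 0 <= t -> f t = g t}.
Proof.
move=> mf [M /completed_ae fM].
have [g mg hg] : exists2 g : R -> R, measurable_fun setT (g : measurableTypeR R -> R) &
    {ae mu, forall t, (f \_ `[0, +oo[) t = g t}.
  apply: borel_modification; apply/(measurable_restrictT _ _).1 => //.
  by apply: sub_caratheodory; exact: measurable_itv.
(* Truncation turns the almost everywhere bound into one valid everywhere and changes [g] only on a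
   null set of the half-line; [|M|] keeps the two thresholds ordered. *)
exists (fun t => Num.max (- `|M|) (Num.min `|M| (g t))).
  by apply: measurable_maxr => //; exact: measurable_minr.
split.
  exists `|M| => t; rewrite ler_norml le_max lexx/= ge_max ge_min lexx/= andbT.
  by rewrite ge0_cp.
have FF := ae_filter_ringOfSetsType mu.
apply: filterS2 fM hg => t fM hg t0.
have tt : t \in `[0, +oo[%classic by rewrite inE /= in_itv/= t0.
rewrite patchE tt in hg; rewrite -hg.
have /ler_normlP[] := le_trans (fM (set_mem tt)) (ler_norm M).
by rewrite lerNl => Mf fM'; rewrite (min_idPr fM') (max_idPr Mf).
Qed.

End LebesgueBorel.

(** * Integrals for the completed measure and for its Borel restriction *)

Section LebesgueIntegral.
Variable R : realType.
Set Implicit Arguments.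
Unset Strict Implicit.
Notation mu := (@lebesgue_measure R).
Notation cmu := (@completed_lebesgue_measure R).
Notation caraR := (caratheodory_type ((wlength (idfun : R -> R))^*)%mu).
Notation borel_fun g := (measurable_fun setT (g : measurableTypeR R -> R)).

Lemma bounded_borel_integrable (g : R -> R) (M : R) (i : interval R) :
  borel_fun g -> (forall t, `|g t| <= M) -> (mu [set` i] < +oo)%E ->
  mu.-integrable [set` i] (EFin \o g).
Proof.
move=> mg gM fini.
apply: measurable_bounded_integrable => //.
  exact: measurable_funTS.
by exists M; split; [exact: num_real|move=> r Mr t _ /=; exact: le_trans (ltW Mr)].
Qed.

Lemma lebesgue_itv_lty (p q : R) (b c : bool) :
  (mu [set` Interval (BSide b p) (BSide c q)] < +oo)%E.
Proof. by rewrite lebesgue_measure_itv /=; case: ifP => _; rewrite ?ltry// -EFinB ltry. Qed.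

(** Completeness makes [F] measurable and lets [G] replace it; the two integrals of [G] agree
    because the identity pushes the completed measure forward to the Borel one. *)
Lemma completed_Rintegral (p q M : R) (F G : R -> R) :
  borel_fun G -> (forall t, `|G t| <= M) ->
  {ae mu, forall t, p <= t -> t <= q -> F t = G t} ->
  \int[cmu]_(t in `[p, q]) F t = \int[mu]_(t in `[p, q]) G t.
Proof.
move=> mG GM FG; rewrite /Rintegral; congr fine.
pose phi : caraR -> measurableTypeR R := id.
have mphi : measurable_fun setT phi.
  by move=> _ A mA; rewrite setTI; exact: sub_caratheodory.
have mI : measurable (`[p, q]%classic : set caraR).
  by apply: sub_caratheodory; exact: measurable_itv.
have mGc : measurable_fun (`[p, q]%classic : set caraR) (fun t => (G t)%:E).
  apply: measurable_funTS; apply/measurable_EFinP.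
  exact: (measurableT_comp (f := G) mG mphi).
have aeFG : ae_eq cmu (`[p, q]%classic : set caraR)
    (fun t => (G t)%:E) (fun t => (F t)%:E).
  apply/completed_ae; have FF := ae_filter_ringOfSetsType mu.
  by apply: filterS FG => t FGt /=; rewrite in_itv/= => /andP[pt tq]; rewrite FGt.
have mFc : measurable_fun (`[p, q]%classic : set caraR) (fun t => (F t)%:E).
  apply: (ae_measurable_fun (mu := cmu) _ aeFG mGc).
  exact: completed_lebesgue_measure_is_complete.
rewrite (ae_eq_integral (mu := cmu) (fun t => (G t)%:E) (fun t => (F t)%:E) mI
  mFc mGc (ae_eq_sym aeFG)).
have intG := bounded_borel_integrable mG GM (lebesgue_itv_lty p q true false).
rewrite -[RHS]/(integral (pushforward cmu phi) _ _).
symmetry; apply: integral_pushforward => //.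
- exact/measurable_EFinP.
- apply: measurable_bounded_integrable => //.
  + exact: lebesgue_itv_lty.
  + by apply: measurable_funTS; exact: (measurableT_comp (f := G) mG mphi).
  + by exists M; split; [exact: num_real|move=> r Mr t _ /=; exact: le_trans (ltW Mr)].
Qed.
End LebesgueIntegral.

(** * Primitives of bounded Borel functions *)

Section Primitive.
Variable R : realType.
Set Implicit Arguments.
Unset Strict Implicit.
Notation mu := (@lebesgue_measure R).
Notation borel_fun g := (measurable_fun setT (g : measurableTypeR R -> R)).
Variables (g : R -> R) (M p : R).
Hypothesis mg : borel_fun g.
Hypothesis gM : forall t, `|g t| <= M.

Let G t := \int[mu]_(s in `[p, t]) g s.

Lemma primitive_sub (s t : R) : p <= s -> s <= t ->
  G t - G s = \int[mu]_(r in `[s, t]) g r.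
Proof.
move=> ps st; rewrite /G Rintegral_itvB ?bnd_simp//.
  rewrite Rintegral_itv_obnd_cbnd//.
  exact: bounded_borel_integrable (lebesgue_itv_lty _ _ _ _).
exact: bounded_borel_integrable (lebesgue_itv_lty _ _ _ _).
Qed.

Lemma primitive_lipschitz (q : R) : lipschitz_on p q G.
Proof.
exists M => s t ps st tq; rewrite primitive_sub//.
have ig : mu.-integrable `[s, t] (EFin \o g).
  exact: bounded_borel_integrable (lebesgue_itv_lty _ _ _ _).
apply: (le_trans (le_normr_Rintegral _ ig)) => //.
apply: (@le_trans _ _ (\int[mu]_(r in `[s, t]) M)).
  apply: le_Rintegral => //.
    apply: (bounded_borel_integrable (M := M)); last exact: lebesgue_itv_lty.
      exact: measurableT_comp.
    by move=> r; rewrite normr_id.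
  apply: (bounded_borel_integrable (g := fun=> M) (M := `|M|)) => //.
  exact: lebesgue_itv_lty.
rewrite Rintegral_cst// -[X in fine X]/(lebesgue_measure `[s, t]).
rewrite lebesgue_measure_itv/= lte_fin.
by have [//|ts] := ltP s t; rewrite mulr0 (_ : s = t) ?subrr ?mulr0//; apply/le_anti/andP.
Qed.

Lemma primitive_ae_derivative :
  {ae mu, forall t, p < t -> is_derive t 1 G (g t)}.
Proof.
have FF := ae_filter_ringOfSetsType mu.
have locg : locally_integrable [set: R] g.
  split => //; first exact: openT.
  move=> K _ cK; have finK := compact_finite_measure cK.
  have mK := compact_measurable cK.
  have : mu.-integrable K (EFin \o g).
    apply: measurable_bounded_integrable => //; first exact: measurable_funTS.
    by exists M; split; [exact: num_real|move=> r Mr t _ /=; exact: le_trans (ltW Mr)].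
  by move=> /integrableP[_]; apply: le_lt_trans.
have ig y : mu.-integrable [set` Interval (BLeft p) (BRight y)] (EFin \o g).
  exact: bounded_borel_integrable (lebesgue_itv_lty _ _ _ _).
apply: filterS (FTC1 ig locg) => t ht pt.
have [dG gt] := ht pt; by rewrite -gt derive1E; exact/derivableP.
Qed.

Lemma primitive_ge0 (t : R) : (forall s, 0 <= g s) -> 0 <= G t.
Proof. by move=> g0; exact: Rintegral_ge0. Qed.

End Primitive.

(** * Riccati supersolutions from each of the three conditions *)

Section RiccatiSupersolution.
Variable R : realType.
Set Implicit Arguments.
Unset Strict Implicit.
Notation mu := (@lebesgue_measure R).
Notation cmu := (@completed_lebesgue_measure R).
Notation borel_fun g := (measurable_fun setT (g : measurableTypeR R -> R)).
Implicit Types (a b u : R -> R) (p q : R).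

(** Putting [x' = - u x] into the equation gives the Riccati equation [u' = u^2 - a u + b]; these
    are its nonnegative supersolutions. *)
Definition riccati_supersolution a b p q u :=
  [/\ absolutely_continuous_on p q u,
      forall t, p <= t -> t <= q -> 0 <= u t
    & {ae mu, forall t, p < t -> t < q ->
        exists2 du, is_derive t 1 u du & b t <= du + u t * (a t - u t)}].

(** With [du = 0], the condition divided by [lambda] reads [b^\+ <= lambda^-1 * (a - lambda^-1)]. *)
Lemma riccati_supersolution_cst a b p q (lambda : R) : 0 < lambda ->
  {ae cmu, forall t, p <= t -> lambda * b^\+ t + lambda^-1 <= a t} ->
  riccati_supersolution a b p q (fun=> lambda^-1).
Proof.
move=> l0 /completed_ae abl; have FF := ae_filter_ringOfSetsType mu.
split.
- apply: lipschitz_ac; exists 0 => s t _ _ _.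
  by rewrite subrr normr0 mul0r.
- by move=> t _ _; rewrite invr_ge0 ltW.
- apply: filterS abl => t abl pt tq; exists 0; first exact: is_derive_cst.
  have := abl (ltW pt); rewrite add0r => {}abl.
  have bb : b t <= b^\+ t by rewrite /funrpos le_max lexx.
  apply: (le_trans bb); rewrite -(ler_pM2l l0) mulrA divff ?gt_eqF// mul1r.
  by lra.
Qed.

Lemma funrpos_borel_modification b : lebesgue_measurable_fun `[0, +oo[ b ->
  ess_bounded `[0, +oo[ b -> exists2 bp : R -> R, borel_fun bp &
    [/\ forall t, 0 <= bp t, exists M, forall t, `|bp t| <= M
      & {ae mu, forall t, 0 <= t -> b^\+ t = bp t}].
Proof.
move=> mb bb; have [g mg [[M gM] bg]] := bounded_borel_modification mb bb.
exists (fun t => Num.max (g t) 0); first exact: measurable_maxr.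
have FF := ae_filter_ringOfSetsType mu.
split=> [t||]; first by rewrite le_max lexx orbT.
  exists M => t; rewrite ger0_norm ?le_max ?lexx ?orbT// ge_max.
  rewrite (le_trans (normr_ge0 (g t)))// andbT.
  exact: le_trans (ler_norm _) (gM t).
by apply: filterS bg => t bg t0; rewrite /funrpos bg.
Qed.

(** Almost everywhere [u' = b^\+ >= b], and the condition says [u <= a], so that
    [u (a - u) >= 0]. *)
Lemma riccati_supersolution_primitive a b p q :
  lebesgue_measurable_fun `[0, +oo[ b -> ess_bounded `[0, +oo[ b -> 0 <= p ->
  {ae cmu, forall t, p <= t -> \int[cmu]_(s in `[p, t]) (b^\+ s) <= a t} ->
  exists u, riccati_supersolution a b p q u.
Proof.
move=> mb bb p0 /completed_ae ab; have FF := ae_filter_ringOfSetsType mu.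
have [g mg [g0 [M gM] bg]] := funrpos_borel_modification mb bb.
pose u t := \int[mu]_(s in `[p, t]) g s.
have uE t : \int[cmu]_(s in `[p, t]) (b^\+ s) = u t.
  apply: completed_Rintegral mg gM _; apply: filterS bg => s bg ps _.
  by apply: bg; exact: le_trans ps.
have u0 t : 0 <= u t by exact: primitive_ge0.
exists u; split => //; first exact/lipschitz_ac/(primitive_lipschitz p mg gM q).
apply: filterS3 ab bg (primitive_ae_derivative p mg gM) => t ab bg du pt tq.
exists (g t); first exact: du.
have bb' : b t <= g t.
  by rewrite -bg ?(le_trans p0 (ltW pt))// /funrpos le_max lexx.
have : 0 <= u t * (a t - u t).
  by rewrite mulr_ge0// subr_ge0 -uE ab// ltW.
by lra.
Qed.

(** Projection onto [[p, q]] does not increase distances. The result serves to make an integrand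
    Borel on the whole line. *)
Lemma lipschitz_on_clamp p q (f : R -> R) : p <= q -> lipschitz_on p q f ->
  continuous (fun s => f (Num.max p (Num.min s q))).
Proof.
move=> pq /lipschitz_on_ge0[L L0 fL] s.
have fcl (r t : R) : r <= t ->
    `|f (Num.max p (Num.min t q)) - f (Num.max p (Num.min r q))| <= L * (t - r).
  move=> rt; apply: (@le_trans _ _ (L * (Num.max p (Num.min t q) - Num.max p (Num.min r q)))).
    apply: fL; first by rewrite le_max lexx.
      by rewrite ge_max !le_max !le_min !ge_min lexx rt /= lexx !orbT.
    by rewrite ge_max pq ge_min lexx orbT.
  rewrite ler_pM2l// /Num.max /Num.min.
  case: (ltP r q); case: (ltP t q) => ? ?; case: ltP => ?; case: ltP => ?; lra.
apply/cvgrPdist_lt => e e0; near=> t.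
have [st|ts] := leP s t.
- rewrite distrC (le_lt_trans (fcl _ _ st))// -ltr_pdivlMl// mulrC.
  by rewrite -[ltLHS]ger0_norm ?subr_ge0// distrC; near: t; apply: cvgr_dist_lt;
    rewrite ?divr_gt0//.
- rewrite (le_lt_trans (fcl _ _ (ltW ts)))// -ltr_pdivlMl// mulrC.
  by rewrite -[ltLHS]ger0_norm ?subr_ge0 ?(ltW ts)//; near: t; apply: cvgr_dist_lt;
    rewrite ?divr_gt0//.
Unshelve. all: by end_near. Qed.

(** Almost everywhere [u' = b^\+ - (a - lambda) u], hence [u' + u (a - u) = b^\+ + u (lambda - u)],
    and the integral condition is exactly [u <= lambda]. *)
Lemma riccati_supersolution_exp_primitive a b p q (lambda : R) :
  lebesgue_measurable_fun `[0, +oo[ a -> ess_bounded `[0, +oo[ a ->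
  lebesgue_measurable_fun `[0, +oo[ b -> ess_bounded `[0, +oo[ b ->
  0 <= p -> p <= q ->
  (forall t, p <= t -> \int[cmu]_(s in `[p, t])
      (expR (- \int[cmu]_(xi in `[s, t]) (a xi - lambda)) * b^\+ s) <= lambda) ->
  exists u, riccati_supersolution a b p q u.
Proof.
move=> ma ba mb bb p0 pq int_le; have FF := ae_filter_ringOfSetsType mu.
have [g mg [g0 [M gM] bg]] := funrpos_borel_modification mb bb.
have [h0 mh0 [[N h0N] ah]] := bounded_borel_modification ma ba.
pose h t := h0 t - lambda.
have mh : borel_fun h by exact: measurable_funB.
have hN t : `|h t| <= N + `|lambda|.
  by rewrite (le_trans (ler_normB _ _))// lerD2r.
pose A t := \int[mu]_(s in `[p, t]) h s.
have lipA : lipschitz_on p q A := primitive_lipschitz p mh hN q.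
have [K AK] := lipschitz_on_bounded lipA.
(* [A] is controlled on [[p, q]] only; clamping makes the integrand [E] Borel and bounded everywhere
   without changing it there. *)
pose Ac s := A (Num.max p (Num.min s q)).
have AcE s : p <= s -> s <= q -> Ac s = A s.
  by move=> ps sq; rewrite /Ac (min_idPl sq) (max_idPr ps).
have AcK s : `|Ac s| <= K.
  by apply: AK; rewrite ?le_max ?lexx// ge_max pq ge_min lexx orbT.
pose E s := expR (Ac s) * g s.
have mE : borel_fun E.
  apply: measurable_funM => //; apply: measurableT_comp => //.
  apply: continuous_measurable_fun; exact: lipschitz_on_clamp.
have EM s : `|E s| <= expR K * M.
  rewrite normrM ler_pM// ger0_norm ?expR_ge0// ler_expR.
  exact: le_trans (ler_norm _) (AcK s).
have E0 s : 0 <= E s by rewrite mulr_ge0// expR_ge0.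
pose B t := \int[mu]_(s in `[p, t]) E s.
have lipB : lipschitz_on p q B := primitive_lipschitz p mE EM q.
pose u t := expR (- A t) * B t.
have acu : absolutely_continuous_on p q u.
  apply: ac_mul; apply: lipschitz_ac => //.
  have lipNA : lipschitz_on p q (fun t => - A t).
    have [L lL] := lipA; exists L => s t ps st tq.
    by rewrite -opprD normrN; exact: lL.
  apply: lipschitz_on_comp lipNA (lipschitz_on_expR (- K) K) => t pt tq.
  by apply/andP; rewrite -ler_norml normrN AK.
have u0 t : 0 <= u t by rewrite mulr_ge0 ?expR_ge0//; exact: primitive_ge0.
have uE t : p <= t -> t <= q -> \int[cmu]_(s in `[p, t])
    (expR (- \int[cmu]_(xi in `[s, t]) (a xi - lambda)) * b^\+ s) = u t.
  move=> pt tq.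
  (* By additivity the kernel is [expR (A s - A t)], whose factor [expR (- A t)] comes out of the
     integral. *)
  have inner s : p <= s -> s <= t ->
      \int[cmu]_(xi in `[s, t]) (a xi - lambda) = A t - A s.
    move=> ps st; rewrite (primitive_sub mh hN)//; apply: completed_Rintegral mh hN _.
    apply: filterS ah => r ah sr _; rewrite ah//.
    exact: le_trans (le_trans p0 ps) sr.
  have intE : mu.-integrable `[p, t] (EFin \o E).
    exact: bounded_borel_integrable mE EM (lebesgue_itv_lty _ _ _ _).
  rewrite /u /B -RintegralZl//.
  apply: (@completed_Rintegral _ _ _ (expR (- A t) * (expR K * M))).
  - exact: measurable_funM.
  - move=> s; rewrite normrM ger0_norm ?expR_ge0// ler_wpM2l ?expR_ge0//.
  - apply: filterS bg => s bg ps st; rewrite inner// bg ?(le_trans p0 ps)//.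
    by rewrite /E AcE ?(le_trans st)// opprB addrC expRD mulrA.
exists u; split => //.
have aebh : {ae mu, forall t, 0 <= t -> b^\+ t = g t /\ a t = h0 t}.
  by apply: filterS2 bg ah => t bgt aht t0; rewrite bgt// aht.
apply: filterS3 aebh (primitive_ae_derivative p mh hN)
  (primitive_ae_derivative p mE EM) => t + dA dB pt tq.
have t0 : 0 <= t by exact: le_trans (ltW pt).
move=> /(_ t0)[bg' ah'].
have bbp : b t <= g t by rewrite -bg'// /funrpos le_max lexx.
have ul : u t <= lambda by rewrite -uE ?int_le ?ltW.
have eA : expR (- A t) * E t = g t.
  by rewrite /E AcE ?ltW// mulrA -expRD addNr expR0 mul1r.
(* Product rule: [expR (- A t)] contributes [- (a t - lambda) * u t], and [B] contributes [g t]. *)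
exists (g t - (a t - lambda) * u t).
  pose NA r := - A r.
  have dNA : is_derive t 1 NA (- h t) := is_deriveN (dA pt).
  have dexpA := is_derive1_comp (is_derive_expR (NA t)) dNA.
  have := is_deriveM dexpA (dB pt) => /is_derive_eq; apply.
  rewrite /GRing.scale/= -[\int[_]_(_ in _) E _]/(B t) eA /h ah'// /u; ring.
have : 0 <= u t * (lambda - u t) by rewrite mulr_ge0// subr_ge0.
by lra.
Qed.

End RiccatiSupersolution.

(** * Solutions of the second order equation and their positivity *)

Section SecondOrderEquation.
Variable R : realType.
Set Implicit Arguments.
Unset Strict Implicit.
Notation mu := (@lebesgue_measure R).
Implicit Types (a b u x y : R -> R) (p q : R).

(** The form used in the comparison: two-sided derivatives inside a compact interval and the
    equation solved for the second derivative. *)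
Definition solution_on a b p q x (x' : R -> R) :=
  [/\ {within `[p, q], continuous x},
      forall t, p < t -> t < q -> is_derive t 1 x (x' t),
      absolutely_continuous_on p q x'
    & {ae mu, forall t, p < t -> t < q ->
        is_derive t 1 x' (- (a t * x' t) - b t * x t)}].

Lemma has_derivative_on_cvg p (x x' : R -> R) : has_derivative_on `[p, +oo[ x x' ->
  forall t e, p <= t -> 0 < e -> exists2 d : R, 0 < d &
    forall r, p <= r -> `|t - r| < d -> r != t ->
      `|x' t - (x r - x t) / (r - t)| < e.
Proof.
move=> dx t e pt e0.
have tp : `[p, +oo[%classic t by rewrite /= in_itv/= pt.
have /cvgrPdist_lt/(_ _ e0) := dx t tp.
rewrite near_withinE => -[d /= d0 xd]; exists d => // r pr trd rt.
by apply: xd => //=; rewrite in_itv/= pr.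
Qed.

Lemma has_derivative_on_is_derive p (x x' : R -> R) :
  has_derivative_on `[p, +oo[ x x' ->
  forall t, p < t -> is_derive t 1 x (x' t).
Proof.
move=> /has_derivative_on_cvg dx t pt; apply/is_derive1_caratheodory.
(* The Caratheodory slope is the difference quotient, completed at [t] by its limit. *)
exists (fun r => if r == t then x' t else (x r - x t) / (r - t)); split.
- move=> z; case: eqP => [->|/eqP zt]; first by rewrite !subrr mulr0.
  by rewrite divfK// subr_eq0.
- apply/cvgrPdist_lt => e e0; have [d d0 xd] := dx t e (ltW pt) e0.
  (* Within [t - p] of [t] one stays to the right of [p], where the one-sided limit applies. *)
  exists (Num.min d (t - p)) => /=; first by rewrite lt_min d0 subr_gt0.
  move=> r /=; rewrite lt_min eqxx => /andP[rd rp].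
  case: eqP => [_|/eqP rt]; first by rewrite subrr normr0.
  apply: xd => //; move: rp; rewrite ltr_norml => /andP[_]; lra.
- by rewrite eqxx.
Qed.

Lemma has_derivative_on_continuous p q (x x' : R -> R) :
  has_derivative_on `[p, +oo[ x x' -> {within `[p, q], continuous x}.
Proof.
move=> /has_derivative_on_cvg dx; apply/subspace_continuousP => t /=.
rewrite in_itv/= => /andP[pt tq]; apply/cvgrPdist_lt => e e0.
(* Tolerance 1 bounds the difference quotients at [t] by [|x' t| + 1] nearby. *)
rewrite near_withinE; have [d d0 xd] := dx t 1 pt ltr01.
have K0 : 0 < `|x' t| + 1 by rewrite ltr_wpDl.
exists (Num.min d (e / (`|x' t| + 1))) => /=.
  by rewrite lt_min d0 divr_gt0.
move=> r /=; rewrite lt_min in_itv/= => /andP[rd re] /andP[pr _].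
rewrite /from_subspace; have [->|rt] := eqVneq r t; first by rewrite subrr normr0.
have := xd r pr rd rt; set m := (_ / _) => mx'.
have -> : x t - x r = m * (t - r).
  by rewrite /m -[t - r]opprB mulrN divfK ?subr_eq0// opprB.
have mK : `|m| <= `|x' t| + 1.
  rewrite -[m](subKr (x' t)) (le_trans (ler_normB _ _))// lerD2l.
  exact: ltW.
rewrite normrM (@le_lt_trans _ _ ((`|x' t| + 1) * `|t - r|))//.
  by rewrite ler_wpM2r.
by rewrite mulrC -ltr_pdivlMr.
Qed.

Lemma ivp_solution_on a b (s x0 v0 : R) x : is_ivp_solution a b s x0 v0 x ->
  exists x', [/\ forall q, s <= q -> solution_on a b s q x x', x s = x0 & x' s = v0].
Proof.
move=> [x' [dx acx' /completed_ae aex [xs x's]]]; exists x'; split=> // q sq.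
have FF := ae_filter_ringOfSetsType mu.
split.
- exact: has_derivative_on_continuous dx.
- by move=> t st _; exact: has_derivative_on_is_derive dx t st.
- exact: acx'.
- apply: filterS aex => t aex st _; have [dx' eq_t] := aex (ltW st).
  have -> : - (a t * x' t) - b t * x t = 'D_1 x' t by rewrite -derive1E; lra.
  exact/derivableP.
Qed.

Lemma solution_onD a b p q x x' y y' (e : R) :
  solution_on a b p q x x' -> solution_on a b p q y y' ->
  solution_on a b p q (fun t => x t + e * y t) (fun t => x' t + e * y' t).
Proof.
move=> [cx dx acx' aex] [cy dy acy' aey].
have FF := ae_filter_ringOfSetsType mu.
have dxD (f g : R -> R) (t df dg : R) : is_derive t 1 f df -> is_derive t 1 g dg ->
    is_derive t 1 (fun t => f t + e * g t) (df + e * dg).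
  by move=> fdf gdg; exact: is_deriveD fdf (is_deriveZ e gdg).
split.
- move=> t; apply: cvgD; first exact: cx.
  by apply: cvgM; [exact: cvg_cst|exact: cy].
- by move=> t pt tq; apply: dxD; [exact: dx|exact: dy].
- apply: ac_add => //; apply: ac_mul => //; apply: lipschitz_ac.
  by exists 0 => s t _ _ _; rewrite subrr normr0 mul0r.
- apply: filterS2 aex aey => t dx' dy' pt tq.
  have := dxD _ _ _ _ _ (dx' pt tq) (dy' pt tq).
  by move=> /is_derive_eq; apply; ring.
Qed.

Definition ae_bounded_on a p q := exists M : R,
  {ae mu, forall t, p < t -> t < q -> `|a t| <= M}.

Lemma ess_bounded_ae_bounded_on a p q :
  ess_bounded `[0, +oo[ a -> 0 <= p -> ae_bounded_on a p q.
Proof.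
move=> [M /completed_ae aM] p0; exists M; have FF := ae_filter_ringOfSetsType mu.
apply: filterS aM => t aM pt _; apply: aM.
by rewrite /= in_itv/= (le_trans p0 (ltW pt)).
Qed.

Lemma solution_on_gt0 a b p q u x x' : ae_bounded_on a p q ->
  riccati_supersolution a b p q u -> solution_on a b p q x x' ->
  0 <= x p -> 0 < x' p + u p * x p ->
  forall t, p < t -> t <= q -> 0 < x t /\ 0 < x' t + u t * x t.
Proof.
move=> [M aM] [acu u0 aeu] [cx dx acx' aex] xp wp t pt tq; split.
  exact: riccati_positive cx dx acx' aex acu u0 aeu aM xp wp t pt tq.
by apply: (riccati_transform_gt0 cx dx acx' aex acu u0 aeu aM xp wp) => //; exact: ltW.
Qed.

Lemma le0_add_small (c d : R) : (forall e, 0 < e -> 0 < c + e * d) -> 0 <= c.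
Proof.
move=> cd; rewrite leNgt; apply/negP => c0.
have d1 : 0 < `|d| + 1 by rewrite ltr_wpDl.
(* For this [e] one gets [e * d <= - c], against the assumed positivity. *)
have e0 : 0 < - c / (`|d| + 1) by rewrite divr_gt0// oppr_gt0.
have := cd _ e0; apply/negP; rewrite -leNgt.
have : - c / (`|d| + 1) * d <= - c / (`|d| + 1) * (`|d| + 1).
  by rewrite ler_pM2l// (le_trans (ler_norm d))// lerDl.
by rewrite divfK ?gt_eqF//; lra.
Qed.

(* Perturbing x by a multiple of y, for which the transformed initial value is
   positive, shows that x and x' + u x are nonnegative. *)
Lemma solution_on_ge0 a b p q u x x' y y' : ae_bounded_on a p q ->
  riccati_supersolution a b p q u -> solution_on a b p q x x' ->
  solution_on a b p q y y' ->
  0 <= x p -> 0 <= x' p + u p * x p -> 0 <= y p -> 0 < y' p + u p * y p ->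
  forall t, p < t -> t <= q -> 0 <= x t /\ 0 <= x' t + u t * x t.
Proof.
move=> aM super solx soly xp wp yp vp t pt tq.
have pos e : 0 < e -> 0 < x t + e * y t /\
    0 < x' t + u t * x t + e * (y' t + u t * y t).
  move=> e0; have := solution_on_gt0 aM super (solution_onD e solx soly).
  case/(_ _ _ t pt tq).
  - by rewrite addr_ge0// mulr_ge0// ltW.
  - have : 0 < e * (y' p + u p * y p) by rewrite mulr_gt0.
    by lra.
  - by move=> xy wv; split => //; lra.
by split; [apply: (le0_add_small (d := y t))|
  apply: (le0_add_small (d := y' t + u t * y t))] => e /pos[].
Qed.

(** Strictness now comes from the initial value: [x' + u x >= 0] keeps [expR (K * t) * x t] at or
    above its value at [p], which is positive. *)
Lemma solution_on_gt0_weak a b p q u x x' : riccati_supersolution a b p q u ->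
  solution_on a b p q x x' -> 0 < x p ->
  (forall t, p < t -> t <= q -> 0 <= x t /\ 0 <= x' t + u t * x t) ->
  forall t, p < t -> t <= q -> 0 < x t.
Proof.
move=> [acu u0 _] [cx dx acx' _] xp xw t pt tq.
have [K K0 uK] := continuous_on_bounded (ac_continuous acu).
pose z r := expR (K * r) * x r.
have dz r : r \in `]p, t[ -> is_derive r 1 z (expR (K * r) * (K * x r + x' r)).
  rewrite in_itv/= => /andP[pr rt]; apply: is_derive_expRM.
  by apply: dx => //; exact: lt_le_trans tq.
have cz : {within `[p, t], continuous z}.
  apply: ac_continuous; apply: ac_expRM; apply: (ac_sub (lexx p) tq).
  have [L L0 x'L] := continuous_on_bounded (ac_continuous acx').
  apply/lipschitz_ac/(derivative_lipschitz_on cx dx (K := L)) => r pr rq.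
  by rewrite x'L// ltW.
have [r /[!in_itv]/= /andP[pr rt] ztp] := MVT pt dz cz.
have rq : r <= q by exact: le_trans (ltW rt) tq.
have : 0 <= z t - z p.
  have [xr wr] := xw r pr rq.
  rewrite ztp !mulr_ge0 ?expR_ge0 ?subr_ge0 ?(ltW pt)//.
  have /ler_normlP[_ urK] : `|u r| <= K by apply: uK => //; exact: ltW.
  have : 0 <= (K - u r) * x r by rewrite mulr_ge0// subr_ge0.
  by lra.
have : 0 < z p by rewrite mulr_gt0// expR_gt0.
move=> zp ztp0; have : 0 < z t by lra.
by rewrite /z pmulr_rgt0// expR_gt0.
Qed.

Lemma riccati_supersolution_sub a b p q p' u : p <= p' ->
  riccati_supersolution a b p q u -> riccati_supersolution a b p' q u.
Proof.
move=> pp [acu u0 aeu]; have FF := ae_filter_ringOfSetsType mu.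
split; first exact: ac_sub acu.
  by move=> t p't; apply: u0; exact: le_trans p't.
by apply: filterS aeu => t aeu p't; apply: aeu; exact: le_lt_trans p't.
Qed.

(** Since [x s = 0] and [x' s = 1], the transform equals 1 at [s] whatever [u s] is. This covers
    both the fundamental function and [x2]. *)
Lemma ivp_solution_gt0 a b p q (s : R) u x : ess_bounded `[0, +oo[ a -> 0 <= p ->
  riccati_supersolution a b p q u -> p <= s -> s < q ->
  is_ivp_solution a b s 0 1 x -> 0 < x q.
Proof.
move=> ba p0 super ps sq /ivp_solution_on[x' [solx xs x's]].
have [] := solution_on_gt0 (ess_bounded_ae_bounded_on q ba (le_trans p0 ps))
  (riccati_supersolution_sub ps super) (solx q (ltW sq)) _ _ sq (lexx q) => //.
- by rewrite xs.
- by rewrite xs x's mulr0 addr0.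
Qed.

End SecondOrderEquation.

Theorem theorem3 (R : realType) (a b : R -> R) (t0 : R)
  (X : R -> R -> R) (x1 x2 : R -> R) :
  lebesgue_measurable_fun `[0, +oo[ a -> ess_bounded `[0, +oo[ a ->
  lebesgue_measurable_fun `[0, +oo[ b -> ess_bounded `[0, +oo[ b ->
  0 <= t0 ->
  [\/ {ae @completed_lebesgue_measure R, forall t : R, t0 <= t ->
        \int[@completed_lebesgue_measure R]_(s in `[t0, t]) (b^\+ s) <= a t},
      exists2 lambda : R, 0 < lambda &
        {ae @completed_lebesgue_measure R, forall t : R, t0 <= t ->
          lambda * b^\+ t + lambda^-1 <= a t}
    | {ae @completed_lebesgue_measure R, forall t : R, t0 <= t -> 0 <= a t} /\
      exists2 lambda : R, 0 < lambda &
        forall t : R, t0 <= t ->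
          \int[@completed_lebesgue_measure R]_(s in `[t0, t])
            (expR (- \int[@completed_lebesgue_measure R]_(xi in `[s, t])
                       (a xi - lambda)) * b^\+ s) <= lambda] ->
  is_fundamental_function a b X ->
  is_fundamental_system a b t0 x1 x2 ->
  [/\ forall s t : R, t0 <= s -> s < t -> 0 < X t s,
      forall t : R, t0 <= t -> 0 < x1 t
    & forall t : R, t0 < t -> 0 < x2 t].
Proof.
move=> ma ba mb bb t00 conds fundX [sol1 sol2].
(* Supersolutions are built on compact intervals; positivity at time [t] uses the one with
   [q = t]. *)
have super q : t0 <= q -> exists u, riccati_supersolution a b t0 q u.
  move=> tq; case: conds => [a_ge|[lambda l0 a_ge]|[_ [lambda _ int_le]]].
  - exact: riccati_supersolution_primitive.
  - by exists (fun=> lambda^-1); exact: riccati_supersolution_cst.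
  - exact: (riccati_supersolution_exp_primitive (lambda := lambda)).
have fund_gt0 s t x : t0 <= s -> s < t -> is_ivp_solution a b s 0 1 x -> 0 < x t.
  move=> ts st solx; have [u superu] := super t (le_trans ts (ltW st)).
  exact: ivp_solution_gt0 ba t00 superu ts st solx.
split=> [s t ts st|t|t tt].
- apply: (fund_gt0 s t (fun r => X r s)) => //; apply: fundX.
  exact: le_trans ts.
- rewrite le_eqVlt => /predU1P[<-|tt].
    by have [_ [_ _ _ [-> _]]] := sol1.
  have [u superu] := super t (ltW tt).
  have [x1' [solx1 x1t x1't]] := ivp_solution_on sol1.
  have [x2' [solx2 x2t x2't]] := ivp_solution_on sol2.
  (* The transform of [x1] starts at [u t0], possibly zero. Perturbation by [x2], whose transform
     starts at 1, gives weak inequalities, and [x1 t0 = 1] then restores strictness. *)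
  have u0 : 0 <= u t0 by case: superu => _ u0 _; rewrite u0// ltW.
  apply: (solution_on_gt0_weak superu (solx1 t (ltW tt)) _ _ tt (lexx t)).
    by rewrite x1t.
  apply: (solution_on_ge0 (ess_bounded_ae_bounded_on t ba t00) superu
    (solx1 t (ltW tt)) (solx2 t (ltW tt))).
  - by rewrite x1t.
  - by rewrite x1t x1't add0r mulr1.
  - by rewrite x2t.
  - by rewrite x2t x2't mulr0 addr0.
- exact: fund_gt0 (lexx t0) tt sol2.
Qed.
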